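(* Let $\mathcal T_h$ be the adjusted mesh obtained from the initial tetrahedral mesh $\mathcal T_h^0$ by the vertex displacement procedure (defined in the context) with a fixed, sufficiently small parameter $\rho>0$, and let $T\in\mathcal T_h$ be a cut tetrahedron, i.e. $T\cap\Gamma\neq\emptyset$. There are constants $c_0,C_0>0$, independent of $h$, such that every vertex $a$ of $T$ satisfies $$2c_0h_T\le|d(a)|\le C_0h_T.$$
   Context: $\Gamma=\{x\in\mathbb{R}^3:F(x)=0\}$ is a compact smooth regular level set ($\nabla F\ne0$ on $\Gamma$), $d$ is the signed distance function to $\Gamma$, and $\pi_\Gamma$ and $n=\nabla d$ are the closest-point projection and unit normal in a tubular neighborhood. $\mathcal T_h^0$ is a conforming tetrahedral mesh of a convex computational box, with mesh size $h$, shape-regular and quasi-uniform: $c_{\rm m}h\le h_T\le C_{\rm m}h$ for all $T\in\mathcal T_h^0$, $h_T=\operatorname{diam}(T)$, constants independent of $h$. Vertex displacement with parameter $\rho>0$ independent of $h$: for each vertex $a$ of $\mathcal T_h^0$, $\widetilde a=a$ if $|d(a)|\ge\rho h$, and $\widetilde a=\pi_\Gamma(a)+\operatorname{sign}(d(a))\,\rho h\,n(\pi_\Gamma(a))$ if $|d(a)|<\rho h$ (if $d(a)=0$ a sign $\pm1$ is assigned by convention). $\mathcal T_h$ is obtained by replacing each $a$ by $\widetilde a$ and keeping the connectivity. ''Sufficiently small'' means $0<\rho\le\rho_*$ with $\rho_*>0$ depending only on the shape-regularity and quasi-uniformity constants of $\mathcal T_h^0$. It is understood that $\rho h$ is smaller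 than the reach of $\Gamma$. *)

(* Defs.v *)
From HB Require Import structures.
From mathcomp Require Import all_boot all_order all_algebra.
From mathcomp Require Import all_classical all_reals all_analysis.
Import Order.TTheory GRing.Theory Num.Theory.
Import numFieldNormedType.Exports.

Set Implicit Arguments.
Unset Strict Implicit.
Unset Printing Implicit Defensive.

Local Open Scope classical_set_scope.
Local Open Scope ring_scope.

(* Points of R^3 are row vectors.  The library norm on 'rV[R]_3 is the sup
   norm: it is used for the topology and for derivatives, where the choice of
   norm is irrelevant.  All metric quantities use the Euclidean norm enorm. *)
Section Geometry.
Variable R : realType.
Implicit Types (x y : 'rV[R]_3) (A B : set 'rV[R]_3).

Definition enorm x : R := Num.sqrt (\sum_i x ord0 i ^+ 2).

Definition edist_set A x : R := inf [set enorm (x - y) | y in A].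

Definition diam A : R := sup [set enorm (p.1 - p.2) | p in A `*` A].

Definition inball_diam A : R :=
  2 * sup [set r : R | 0 <= r /\
             exists x, [set y | enorm (y - x) <= r] `<=` A].

Definition nearest A x : set 'rV[R]_3 :=
  [set y | A y /\ enorm (x - y) = edist_set A x].

(* Reach in the sense of Federer. *)
Definition reach A : \bar R :=
  ereal_sup [set r%:E | r in
    [set r : R | forall x, edist_set A x < r -> exists! y, nearest A x y]].

Definition basis_vec (i : 'I_3) : 'rV[R]_3 := delta_mx ord0 i.

Definition grad (f : 'rV[R]_3 -> R) x : 'rV[R]_3 :=
  \row_i 'D_(basis_vec i) f x.

Fixpoint class_C (k : nat) (f : 'rV[R]_3 -> R) : Prop :=
  match k with
  | 0 => continuous f
  | k'.+1 => continuous f /\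
      forall i, (forall x, derivable f x (basis_vec i)) /\
                class_C k' ('D_(basis_vec i) f)
  end.

Definition smooth (f : 'rV[R]_3 -> R) : Prop := forall k, class_C k f.

Definition box (lo hi : 'rV[R]_3) : set 'rV[R]_3 :=
  [set x | forall i, lo ord0 i <= x ord0 i <= hi ord0 i].

End Geometry.

Section LevelSet.
Variables (R : realType) (F : 'rV[R]_3 -> R).

Definition Gamma : set 'rV[R]_3 := [set x | F x = 0].

Definition compact_smooth_regular_level_set : Prop :=
  [/\ smooth F, compact Gamma & forall x, Gamma x -> grad F x != 0].

(* Negative where F < 0, positive where F > 0. *)
Definition sdist (x : 'rV[R]_3) : R := Num.sg (F x) * edist_set Gamma x.

(* Only meaningful at points with a unique nearest point on Gamma, in
   particular at distance less than the reach. *)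
Definition proj (x : 'rV[R]_3) : 'rV[R]_3 := xget 0 (nearest Gamma x).

Definition normal (x : 'rV[R]_3) : 'rV[R]_3 := grad sdist x.

(* b a selects the sign assigned by convention when sdist a = 0. *)
Definition side (b : 'rV[R]_3 -> bool) (a : 'rV[R]_3) : R :=
  if sdist a == 0 then (-1) ^+ b a else Num.sg (sdist a).

Definition displace (b : 'rV[R]_3 -> bool) (rho h : R) (a : 'rV[R]_3) :
    'rV[R]_3 :=
  if rho * h <= `|sdist a| then a
  else proj a + (side b a * (rho * h)) *: normal (proj a).

End LevelSet.

(* A mesh consists of the positions of its vertices and of its connectivity:
   each cell is a set of vertices. *)
Record mesh (R : realType) := Mesh {
  vertex : finType;
  pos : vertex -> 'rV[R]_3;
  cells : {set {set vertex}} }.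

Section Meshes.
Variables (R : realType) (M : mesh R).
Implicit Types (K L : {set vertex M}).

Definition simplex K : set 'rV[R]_3 :=
  [set x | exists w : vertex M -> R,
     [/\ forall v, 0 <= w v, \sum_(v in K) w v = 1 &
         x = \sum_(v in K) w v *: pos v]].

Definition affinely_independent K : Prop :=
  forall w : vertex M -> R,
    \sum_(v in K) w v = 0 -> \sum_(v in K) w v *: pos v = 0 ->
    forall v, v \in K -> w v = 0.

Definition conforming_tetrahedral_mesh (D : set 'rV[R]_3) : Prop :=
  [/\ forall K, K \in cells M -> #|K| = 4%N /\ affinely_independent K,
      forall v : vertex M, exists2 K, K \in cells M & v \in K,
      \bigcup_(K in [set K | K \in cells M]) simplex K = D &
      forall K L, K \in cells M -> L \in cells M ->
        simplex K `&` simplex L = simplex (K :&: L)].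

Definition shape_regular (sigma : R) : Prop :=
  forall K, K \in cells M ->
    diam (simplex K) <= sigma * inball_diam (simplex K).

Definition quasi_uniform (cm CM h : R) : Prop :=
  forall K, K \in cells M ->
    cm * h <= diam (simplex K) /\ diam (simplex K) <= CM * h.

Definition move_vertices (g : 'rV[R]_3 -> 'rV[R]_3) : mesh R :=
  @Mesh R (vertex M) (fun v => g (pos v)) (cells M).

End Meshes.

Definition adjusted_mesh (R : realType) (F : 'rV[R]_3 -> R)
    (b : 'rV[R]_3 -> bool) (rho h : R) (M0 : mesh R) : mesh R :=
  move_vertices M0 (displace F b rho h).

(* Main.v *)
Require Import Defs.
From HB Require Import structures.
From mathcomp Require Import all_boot all_order all_algebra.
From mathcomp Require Import all_classical all_reals all_analysis.
From mathcomp Require Import ring lra.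
Import Order.TTheory GRing.Theory Num.Theory.
Import numFieldNormedType.Exports.

Set Implicit Arguments.
Unset Strict Implicit.
Unset Printing Implicit Defensive.

Local Open Scope classical_set_scope.
Local Open Scope ring_scope.

(** Why the estimate holds.  Write [r = rho * h].

    The upper bound is immediate: a cut tetrahedron contains a point of
    [Gamma], and each of its vertices is within one diameter of that point.

    For the lower bound it suffices that every displaced vertex is at distance
    at least [r] from [Gamma] and that it has moved by at most [2 r]; the
    latter gives [diam T <= (CM + 4 rho) h], so that [r] is a fixed multiple of
    an upper bound for [diam T].  Both facts follow once the unit normal
    segment of length [r] issued from a point [p] of [Gamma] is known to end
    at distance exactly [r] from [Gamma] whenever [r] is smaller than the
    reach ([edist_set_normal_segment]).

    This is a theorem of Federer, usually proved by following the gradient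
    flow of the distance function.  The flow is replaced here by a variational
    argument that uses only compactness.
    - Where the nearest point is unique, the distance to a compact set grows
      at unit speed in the direction away from that point
      ([edist_set_ascent]).
    - Fix a side of [Gamma] and a number [c < 1], and maximize
      [dist x - c * |x - p|] over the half ball of radius [r] around [p].  Near
      [p] in the normal direction this quantity takes positive values, so the
      maximizer is off [Gamma]; there the first fact applies, since its
      distance to [Gamma] is at most [r], and it forces the maximizer onto the
      sphere.  Hence the sphere contains points at distance at least [c r]
      from [Gamma], and by compactness, letting [c] tend to 1, a point [x] at
      distance [r].
    - The distance to [Gamma] of any point of the segment from [p] to [x] then
      equals its distance to [p].  Since the signed distance has the
      first-order expansion [<n, w>] at [p], the direction of the segment is
      [n] or [- n] according to the side.

    The expansion of the signed distance ([sdist_expands]) comes from that of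
    [F] at [p], whose gradient is nonzero, and from the intermediate value
    theorem; it also shows that the partial derivatives of the signed distance
    at [p] form a unit vector. *)

(** * Euclidean geometry of R^3 *)

Section Euclidean.
Variable R : realType.
Implicit Types x y z : 'rV[R]_3.

Definition dot x y : R := \sum_i x ord0 i * y ord0 i.

Lemma dotC x y : dot x y = dot y x.
Proof. by apply: eq_bigr => i _; rewrite mulrC. Qed.

Lemma dotDl x y z : dot (x + y) z = dot x z + dot y z.
Proof. by rewrite -big_split; apply: eq_bigr => i _; rewrite mxE mulrDl. Qed.

Lemma dotZl a x z : dot (a *: x) z = a * dot x z.
Proof. by rewrite mulr_sumr; apply: eq_bigr => i _; rewrite mxE mulrA. Qed.

Lemma dotNl x z : dot (- x) z = - dot x z.
Proof. by rewrite -scaleN1r dotZl mulN1r. Qed.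

Lemma dotDr z x y : dot z (x + y) = dot z x + dot z y.
Proof. by rewrite dotC dotDl !(dotC z). Qed.

Lemma dotZr a z x : dot z (a *: x) = a * dot z x.
Proof. by rewrite dotC dotZl (dotC z). Qed.

Lemma dotNr z x : dot z (- x) = - dot z x.
Proof. by rewrite dotC dotNl (dotC z). Qed.

Definition dotE := (dotDl, dotDr, dotNl, dotNr, dotZl, dotZr).

Lemma dot_basis_vec x i : dot x (basis_vec R i) = x ord0 i.
Proof.
rewrite /dot (bigD1 i) //= big1 => [|j ji]; rewrite /basis_vec mxE eqxx/=.
  by rewrite eqxx mulr1 addr0.
by rewrite (negPf ji) mulr0.
Qed.

Lemma enorm_ge0 x : 0 <= enorm x.
Proof. exact: sqrtr_ge0. Qed.

Lemma sqr_enorm x : enorm x ^+ 2 = dot x x.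
Proof.
rewrite sqr_sqrtr; first by apply: eq_bigr => i _; rewrite expr2.
by apply: sumr_ge0 => i _; rewrite sqr_ge0.
Qed.

Lemma enorm0 : enorm (0 : 'rV[R]_3) = 0.
Proof.
apply/eqP; rewrite -(sqrf_eq0 (enorm _)) sqr_enorm /dot big1// => i _.
by rewrite mxE mul0r.
Qed.

Lemma enormZ a x : enorm (a *: x) = `|a| * enorm x.
Proof.
apply/eqP; rewrite -(@eqrXn2 _ 2) ?mulr_ge0 ?enorm_ge0//.
by rewrite exprMn !sqr_enorm !dotE real_normK ?num_real// expr2 mulrA.
Qed.

Lemma enormN x : enorm (- x) = enorm x.
Proof. by rewrite -scaleN1r enormZ normrN1 mul1r. Qed.

Lemma enormB x y : enorm (x - y) = enorm (y - x).
Proof. by rewrite -enormN opprB. Qed.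

Lemma coord_le_enorm x i : `|x ord0 i| <= enorm x.
Proof.
rewrite -ler_sqr ?nnegrE ?enorm_ge0// real_normK ?num_real// sqr_enorm.
rewrite /dot (bigD1 i)//= -expr2 lerDl sumr_ge0// => j _.
by rewrite -expr2 sqr_ge0.
Qed.

Lemma enorm_eq0 x : (enorm x == 0) = (x == 0).
Proof.
apply/eqP/eqP => [x0|->]; last exact: enorm0.
apply/rowP => i; rewrite mxE; apply/eqP; rewrite -normr_le0 -x0.
exact: coord_le_enorm.
Qed.

Lemma enorm_gt0 x : (0 < enorm x) = (x != 0).
Proof. by rewrite lt_def enorm_ge0 andbT enorm_eq0. Qed.

Lemma enorm_basis_vec i : enorm (basis_vec R i) = 1.
Proof.
apply/eqP; rewrite -(@eqrXn2 _ 2) ?enorm_ge0// sqr_enorm dot_basis_vec.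
by rewrite /basis_vec mxE !eqxx expr1n.
Qed.

(** Cauchy-Schwarz, from the nonnegative squared norm of [dot y y] times the
    component of [x] orthogonal to [y]. *)
Lemma dot_le_enorm x y : `|dot x y| <= enorm x * enorm y.
Proof.
have [->|y0] := eqVneq y 0.
  by rewrite enorm0 mulr0 -(scale0r 0) dotZr mul0r normr0.
have ygt : 0 < dot y y by rewrite -sqr_enorm exprn_gt0// enorm_gt0.
rewrite -ler_sqr ?nnegrE ?mulr_ge0 ?enorm_ge0// real_normK ?num_real//.
rewrite exprMn !sqr_enorm -subr_ge0 -(pmulr_rge0 _ ygt).
have := sqr_ge0 (enorm (dot y y *: x - dot x y *: y)).
rewrite sqr_enorm !dotE (dotC y x) => /le_trans; apply.
by rewrite le_eqVlt; apply/orP; left; apply/eqP; ring.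
Qed.

Lemma sqr_enormD x y :
  enorm (x + y) ^+ 2 = enorm x ^+ 2 + 2 * dot x y + enorm y ^+ 2.
Proof. by rewrite !sqr_enorm !dotE (dotC y x); ring. Qed.

Lemma enormD x y : enorm (x + y) <= enorm x + enorm y.
Proof.
rewrite -ler_sqr ?nnegrE ?addr_ge0 ?enorm_ge0// sqr_enormD.
have := le_trans (ler_norm _) (dot_le_enorm x y).
by rewrite sqrrD; lra.
Qed.

Lemma enorm_triangle y x z : enorm (x - z) <= enorm (x - y) + enorm (y - z).
Proof. by rewrite -{1}(subrK y x) -addrA enormD. Qed.

Lemma enorm_sum (I : finType) (P : pred I) (f : I -> 'rV[R]_3) :
  enorm (\sum_(i | P i) f i) <= \sum_(i | P i) enorm (f i).
Proof.
apply: (big_ind2 (fun x a => enorm x <= a)); rewrite ?enorm0//.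
by move=> x a y b xa yb; rewrite (le_trans (enormD _ _)) ?lerD.
Qed.

Lemma dot_unit_le u x : enorm u = 1 -> `|dot u x| <= enorm x.
Proof. by move=> u1; rewrite (le_trans (dot_le_enorm _ _))// u1 mul1r. Qed.

(** Equality case of Cauchy-Schwarz for unit vectors. *)
Lemma dot_unit_eq1 u v : enorm u = 1 -> enorm v = 1 -> dot u v = 1 -> u = v.
Proof.
move=> u1 v1 uv; apply/eqP; rewrite -subr_eq0 -enorm_eq0.
rewrite -(sqrf_eq0 (enorm _)) sqr_enormD enormN u1 v1 dotNr uv.
by apply/eqP; ring.
Qed.

(** Together with [enorm_le_norm], this transfers topological statements, which
    are phrased with the sup norm [`|x|], to the Euclidean norm. *)
Lemma norm_le_enorm x : `|x| <= enorm x.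
Proof.
rewrite [`|x|]mx_normE; apply: (big_ind (fun a : {nonneg R} => a%:num <= _)).
- exact: enorm_ge0.
- by move=> a b /= a_le b_le; rewrite num_max /= ge_max a_le.
- by case=> i j _ /=; rewrite (ord1 i); exact: coord_le_enorm.
Qed.

Lemma enorm_le_norm x : enorm x <= 3 * `|x|.
Proof.
have coord i : `|x ord0 i| <= `|x|.
  rewrite [leRHS]mx_normrE.
  exact: (le_bigmax _ (fun ij => `|x ij.1 ij.2|) (ord0, i)).
have {1}-> : x = \sum_i x ord0 i *: basis_vec R i.
  by rewrite {1}[x]matrix_sum_delta big_ord1.
apply: le_trans (enorm_sum _ _) _.
have -> : 3 * `|x| = \sum_(i < 3) `|x| by rewrite sumr_const card_ord mulr_natl.
by apply: ler_sum => i _; rewrite enormZ enorm_basis_vec mulr1.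
Qed.

End Euclidean.

(** * Topology of R^3 in terms of the Euclidean norm *)

Section Topology.
Variable R : realType.
Implicit Types (x y p : 'rV[R]_3) (A : set 'rV[R]_3) (f : 'rV[R]_3 -> R).

Lemma lipschitz_continuous f :
  (forall x y, f x - f y <= enorm (x - y)) -> continuous f.
Proof.
move=> lip x; apply/(cvgrPdist_lt (FF := nbhs_filter x)) => e e0.
apply/nbhs_ballP.
exists (e / 3) => [|y]; first by rewrite /= divr_gt0.
rewrite -ball_normE /= ltr_pdivlMr// mulrC => /(le_lt_trans (enorm_le_norm _)).
by apply: le_lt_trans; rewrite ler_norml lip andbT lerNl opprB enormB lip.
Qed.

Lemma continuous_enorm_ball f x (e : R) : {for x, continuous f} -> 0 < e ->
  exists2 d : R, 0 < d &
    forall y, enorm (y - x) < d -> `|f y - f x| < e.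
Proof.
move=> fc e0; move: fc => /(cvgrPdist_lt (FF := nbhs_filter x))/(_ _ e0).
move=> /nbhs_ballP[d /= d0 fd].
exists d => // y yx; rewrite distrC; apply: fd.
rewrite -ball_normE /= distrC; exact: le_lt_trans (norm_le_enorm _) yx.
Qed.

Lemma enorm_bounded_compact p (r : R) A :
  closed A -> (forall x, A x -> enorm (x - p) <= r) -> compact A.
Proof.
move=> clA Ar; apply: bounded_closed_compact => //.
exists (r + `|p|); split; first exact: num_real.
move=> M rM x /Ar xr /=; apply: le_trans (ltW rM); rewrite -lerBlDr.
by apply: (le_trans (lerB_dist x p)); apply: le_trans xr; exact: norm_le_enorm.
Qed.

Lemma closed_sublevel f (c : R) : continuous f -> closed [set x | f x <= c].
Proof.
move=> fc; have := @closed_le R c.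
by move=> /(closed_comp (fun x _ => fc x)).
Qed.

Lemma closed_superlevel f (c : R) : continuous f -> closed [set x | c <= f x].
Proof.
move=> fc; have := @closed_ge R c.
by move=> /(closed_comp (fun x _ => fc x)).
Qed.

Lemma continuous_scale (c : R) f :
  continuous f -> continuous (fun x => c * f x).
Proof.
move=> fc x.
exact: (@continuous_comp _ _ _ f ( *%R c) x (fc x) (@mulrl_continuous _ c _)).
Qed.

Lemma compact_argmax f A : A !=set0 -> compact A -> continuous f ->
  exists2 c, A c & forall t, A t -> f t <= f c.
Proof.
move=> A0 cA fc.
have [] := compact_EVT_max A0 cA (@continuous_subspaceT _ _ A f fc).
move=> c /set_mem Ac fmax; exists c => // t At; apply: fmax.
exact: mem_set.
Qed.

Lemma compact_argmin f A : A !=set0 -> compact A -> continuous f ->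
  exists2 c, A c & forall t, A t -> f c <= f t.
Proof.
move=> A0 cA fc.
have [] := compact_EVT_min A0 cA (@continuous_subspaceT _ _ A f fc).
move=> c /set_mem Ac fmin; exists c => // t At; apply: fmin.
exact: mem_set.
Qed.

Lemma IVT_segment f x y : continuous f -> f x <= 0 -> 0 <= f y ->
  exists t : R, [/\ 0 <= t, t <= 1 & f (x + t *: (y - x)) = 0].
Proof.
move=> fc fx fy.
pose g (t : R) := f (x + t *: (y - x)).
have gc : continuous g.
  move=> t; apply: continuous_comp; last exact: fc.
  by apply: cvgD; [exact: cvg_cst|apply: cvgZr_tmp; exact: cvg_id].
have [|t] := @IVT R g 0 1 0 ler01 (@continuous_subspaceT _ _ _ g gc).
  rewrite /g scale0r addr0 scale1r subrKC.
  by rewrite ge_min fx le_max fy orbT.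
by rewrite in_itv/= => /andP[t0 t1] gt; exists t.
Qed.

End Topology.

(** * Distance to a set *)

Section Distance.
Variable R : realType.
Implicit Types (x y : 'rV[R]_3) (A : set 'rV[R]_3).

Let has_lbound_dist A x : has_lbound [set enorm (x - y) | y in A].
Proof. by exists 0 => _ [y _ <-]; exact: enorm_ge0. Qed.

Lemma edist_set_le A x y : A y -> edist_set A x <= enorm (x - y).
Proof. by move=> Ay; apply: ge_inf; [exact: has_lbound_dist|exists y]. Qed.

Lemma edist_set_ge A x (c : R) : A !=set0 ->
  (forall y, A y -> c <= enorm (x - y)) -> c <= edist_set A x.
Proof.
move=> [a Aa] cA; apply: lb_le_inf; first by exists (enorm (x - a)), a.
by move=> _ [y /cA + <-].
Qed.

Lemma edist_set_ge0 A x : 0 <= edist_set A x.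
Proof.
have [->|/set0P A0] := eqVneq A set0.
  by rewrite /edist_set image_set0 inf0.
by apply: edist_set_ge => // y _; exact: enorm_ge0.
Qed.

Lemma edist_set0 A x : A x -> edist_set A x = 0.
Proof.
move=> Ax; apply/eqP; rewrite eq_le edist_set_ge0 andbT.
by rewrite (le_trans (edist_set_le _ Ax))// subrr enorm0.
Qed.

Lemma edist_set_lip A x y : A !=set0 ->
  edist_set A x - edist_set A y <= enorm (x - y).
Proof.
move=> A0; rewrite lerBlDl -lerBlDr; apply: edist_set_ge => // z Az.
rewrite lerBlDl; apply: le_trans (enorm_triangle y _ _).
exact: edist_set_le.
Qed.

Lemma edist_set_continuous A : A !=set0 -> continuous (edist_set A).
Proof.
by move=> A0; apply: lipschitz_continuous => x y; exact: edist_set_lip.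
Qed.

Lemma dist_continuous x : continuous (fun y => enorm (y - x)).
Proof.
apply: lipschitz_continuous => y z; rewrite lerBlDr; exact: enorm_triangle.
Qed.

End Distance.

(** * First-order expansions *)

Section Expansion.
Variable R : realType.
Implicit Types (x y p w g : 'rV[R]_3) (f : 'rV[R]_3 -> R).

(** Frechet differentiability at [p] with gradient [g], in epsilon-delta form
    and for the Euclidean norm. *)
Definition expands f p g := forall e : R, 0 < e ->
  exists2 d : R, 0 < d &
    forall w, enorm w < d -> `|f (p + w) - f p - dot g w| <= e * enorm w.

Lemma expands_grad f p g : expands f p g -> grad f p = g.
Proof.
move=> fg; apply/rowP => i; rewrite mxE; apply: cvg_lim => //.
apply/cvgrPdist_le => e e0; have [d d0 fd] := fg _ e0.
near=> h.
have h0 : h != 0 by near: h; exact: nbhs_dnbhs_neq.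
have hd : `|h| < d.
  near: h; apply: (@dnbhs0_lt _ R) => //.
have nh : enorm (h *: basis_vec R i) = `|h|.
  by rewrite enormZ enorm_basis_vec mulr1.
have := fd (h *: basis_vec R i); rewrite nh => /(_ hd).
rewrite dotZr dot_basis_vec /= [_ + p]addrC => le_eh.
rewrite -(@ler_pM2l _ `|h|) ?normr_gt0// -normrM mulrC [X in _ <= X]mulrC.
apply: le_trans le_eh; rewrite distrC mulrC le_eqVlt; apply/orP; left.
by apply/eqP; congr `| _ |; rewrite /GRing.scale/=; field.
Unshelve. all: by end_near. Qed.

Lemma partial_MVT f i : (forall x, derivable f x (basis_vec R i)) ->
  forall x (t : R), exists2 s : R, `|s| <= `|t| &
    f (x + t *: basis_vec R i) - f x =
    t * 'D_(basis_vec R i) f (x + s *: basis_vec R i).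
Proof.
move=> df x t; set v := basis_vec R i.
pose g (s : R) := f (x + s *: v).
have dg s : @is_derive R R R s 1 g ('D_v f (x + s *: v)).
  have quot : (fun h => h^-1 *: ((g \o shift s) (h *: (1 : R)) - g s)) =
      (fun h => h^-1 *: ((f \o shift (x + s *: v)) (h *: v) - f (x + s *: v))).
    apply/funext => h; rewrite /g /=; congr (_ *: (f _ - _)).
    by rewrite [h *: 1]mulr1 scalerDl addrCA.
  split; first by rewrite /derivable quot; exact: df.
  by rewrite /derive quot.
have gc : continuous g.
  by move=> s; apply/differentiable_continuous/derivable1_diffP; case: (dg s).
have [t0|t0] := leP 0 t.
  have [s] := @MVT_segment R g _ 0 t t0 (fun s _ => dg s)
    (@continuous_subspaceT _ _ _ g gc).
  rewrite in_itv/= => /andP[s0 st]; rewrite /g scale0r addr0 subr0 => E.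
  by exists s; rewrite ?ger0_norm// E mulrC.
have [s] := @MVT_segment R g _ t 0 (ltW t0) (fun s _ => dg s)
    (@continuous_subspaceT _ _ _ g gc).
rewrite in_itv/= => /andP[ts s0]; rewrite /g scale0r addr0 sub0r => E.
exists s; first by rewrite !ler0_norm ?lerN2// ltW.
by rewrite -[LHS]opprB E mulrN opprK mulrC.
Qed.

(** Moving from [p] to [p + w] one coordinate at a time, the mean value
    theorem evaluates a partial derivative within distance [3 |w|] of [p]. *)
Lemma class_C1_expands f p : class_C 1 f -> expands f p (grad f p).
Proof.
move=> [_ C1] e e0.
have e3 : 0 < e / 3 by rewrite divr_gt0.
have loc i : exists2 d : R, 0 < d & forall y, enorm (y - p) < d ->
    `|'D_(basis_vec R i) f y - 'D_(basis_vec R i) f p| < e / 3.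
  by apply: continuous_enorm_ball => //; have [_] := C1 i; apply.
have [d0 d0_gt0 D0] := loc ord0.
have [d1 d1_gt0 D1] := loc (lift ord0 ord0).
have [d2 d2_gt0 D2] := loc (lift ord0 (lift ord0 ord0)).
pose d := Num.min d0 (Num.min d1 d2).
have d_gt0 : 0 < d by rewrite !lt_min d0_gt0 d1_gt0 d2_gt0.
have step i di q t : d <= di -> (forall y, enorm (y - p) < di ->
      `|'D_(basis_vec R i) f y - 'D_(basis_vec R i) f p| < e / 3) ->
    enorm (q - p) + `|t| < d ->
    `|f (q + t *: basis_vec R i) - f q - t * 'D_(basis_vec R i) f p|
      <= e / 3 * `|t|.
  move=> ddi Di qt; have [s st ->] := partial_MVT (fun x => (C1 i).1 x) q t.
  rewrite -mulrBr normrM mulrC ler_wpM2r// ltW// Di//.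
  apply: lt_le_trans ddi; apply: le_lt_trans qt.
  rewrite addrAC (le_trans (enormD _ _))// lerD2l enormZ enorm_basis_vec.
  by rewrite mulr1.
exists (d / 3) => [|w wd]; first by rewrite divr_gt0.
have {}wd : 3 * enorm w < d by rewrite mulrC -ltr_pdivlMr.
pose e0' := basis_vec R ord0; pose e1 := basis_vec R (lift ord0 ord0).
pose e2 := basis_vec R (lift ord0 (lift ord0 ord0)).
pose w0 := w ord0 ord0; pose w1 := w ord0 (lift ord0 ord0).
pose w2 := w ord0 (lift ord0 (lift ord0 ord0)).
have wE : w = w0 *: e0' + w1 *: e1 + w2 *: e2.
  rewrite {1}[w]matrix_sum_delta big_ord1 !big_ord_recl big_ord0 addr0 addrA.
  by [].
have w0_le : `|w0| <= enorm w by exact: coord_le_enorm.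
have w1_le : `|w1| <= enorm w by exact: coord_le_enorm.
have w2_le : `|w2| <= enorm w by exact: coord_le_enorm.
have w_ge0 := enorm_ge0 w.
have n0 : enorm (w0 *: e0') = `|w0| by rewrite enormZ enorm_basis_vec mulr1.
have n1 : enorm (w1 *: e1) = `|w1| by rewrite enormZ enorm_basis_vec mulr1.
have := enormD (w0 *: e0') (w1 *: e1); rewrite n0 n1 => n01.
have dist0 : `|w0| < d by clear -w0_le w_ge0 wd; lra.
have dist1 : `|w0| + `|w1| < d by clear -w0_le w1_le w_ge0 wd; lra.
have dist2 : enorm (w0 *: e0' + w1 *: e1) + `|w2| < d.
  by clear -n01 w0_le w1_le w2_le wd; lra.
have := @step _ _ p w0 _ D0.
have := @step _ _ (p + w0 *: e0') w1 _ D1.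
have := @step _ _ (p + w0 *: e0' + w1 *: e1) w2 _ D2.
rewrite -/e0' -/e1 -/e2 !ge_min !lexx !orbT /= subrr enorm0.
rewrite -[p + _ + _]addrA ![p + _ - p]addrAC subrr !add0r n0.
rewrite -[_ + _ + w2 *: _]addrA -wE.
move=> /(_ isT dist2) S2 /(_ isT dist1) S1 /(_ isT dist0) S0.
rewrite /dot !big_ord_recl big_ord0 addr0 -/w0 -/w1 -/w2 !mxE.
move: S0 S1 S2.
set a0 := 'D_ _ _ _; set a1 := 'D_ _ _ _; set a2 := 'D_ _ _ _.
set f0 := f _; set f1 := f _; set f2 := f _; set f3 := f _ => S0 S1 S2.
have -> : f3 - f1 - (a0 * w0 + (a1 * w1 + a2 * w2)) =
    (f0 - f1 - w0 * a0) + (f2 - f0 - w1 * a1) + (f3 - f2 - w2 * a2) by ring.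
have third (t : R) : `|t| <= enorm w -> e / 3 * `|t| <= e / 3 * enorm w.
  by move=> tw; rewrite ler_wpM2l// ltW.
have -> : e * enorm w = e / 3 * enorm w + e / 3 * enorm w + e / 3 * enorm w.
  by field.
apply: le_trans (ler_normD _ _) (lerD _ (le_trans S2 (third _ w2_le))).
exact: le_trans (ler_normD _ _)
  (lerD (le_trans S0 (third _ w0_le)) (le_trans S1 (third _ w1_le))).
Qed.

End Expansion.

(** * The signed distance near a regular zero *)

Section SignedDistance.
Variables (R : realType) (F : 'rV[R]_3 -> R).
Hypothesis F_cont : continuous F.
Implicit Types (x y p w g : 'rV[R]_3).

Lemma normr_sdist x : `|sdist F x| = edist_set (Gamma F) x.
Proof.
have [Fx|Fx] := eqVneq (F x) 0.
  by rewrite /sdist edist_set0// mulr0 normr0.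
by rewrite normrM normr_sg Fx mul1r ger0_norm// edist_set_ge0.
Qed.

(** Seen from [p], the zeros of [F] near [p] are nearly orthogonal to [n], so
    none of them is much closer to [p + w] than [|<n, w>|].  Conversely, [F]
    changes sign along the line through [p + w] directed by [n], close to its
    intersection with the plane through [p] orthogonal to [n]; the
    intermediate value theorem yields a zero at distance about [|<n, w>|]. *)
Lemma sdist_expands p g : F p = 0 -> g != 0 -> expands F p g ->
  expands (sdist F) p ((enorm g)^-1 *: g).
Proof.
move=> Fp g0 Fg e e0.
have N0 : 0 < enorm g by rewrite enorm_gt0.
set N := enorm g in N0 *; set n := N^-1 *: g.
have n1 : enorm n = 1.
  by rewrite enormZ ger0_norm ?invr_ge0 ?(ltW N0)// mulVf// gt_eqF.
have gn x : dot g x = N * dot n x by rewrite dotZl mulrA divff ?mul1r// gt_eqF.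
(* Errors are counted in units of 3 e1 L.  When |<n, w>| is below one unit the
   sign of F (p + w) is unknown and the total error is three units, whence
   e / 9; the bound 1 / 3 keeps the points considered within 3 L of p. *)
pose e1 := Num.min (e / 9) (1 / 3).
have e1_gt0 : 0 < e1 by rewrite lt_min !divr_gt0.
have e1_le : 9 * e1 <= e by rewrite mulrC -ler_pdivlMr// ge_min lexx.
have e1_le3 : 3 * e1 <= 1 by rewrite mulrC -ler_pdivlMr// ge_min lexx orbT.
have [d d0 Fd] := Fg _ (mulr_gt0 N0 e1_gt0).
exists (d / 3) => [|w]; first by rewrite divr_gt0.
rewrite ltr_pdivlMr// mulrC => wd.
set L := enorm w in wd *; have L0 : 0 <= L := enorm_ge0 w.
(* the values of F near p, up to the positive factor N *)
have Fv v : enorm v <= 3 * L ->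
    N * (dot n v - 3 * e1 * L) <= F (p + v) <= N * (dot n v + 3 * e1 * L).
  move=> vL; have := Fd v (le_lt_trans vL wd).
  rewrite Fp subr0 gn ler_norml => /andP[lo hi].
  have : N * e1 * enorm v <= N * e1 * (3 * L).
    by rewrite ler_pM2l// mulr_gt0.
  by move=> vL'; apply/andP; split; lra.
set a := dot n w; have aL : `|a| <= L by exact: dot_unit_le.
have p_Gamma : Gamma F p by [].
have upper : edist_set (Gamma F) (p + w) <= `|a| + 3 * e1 * L.
  pose s1 := - a - 3 * e1 * L; pose s2 := - a + 3 * e1 * L.
  have e1L : 0 <= 3 * e1 * L by rewrite !mulr_ge0// ltW.
  have e1L' : 3 * e1 * L <= L by rewrite ler_piMl.
  have in_range (s : R) : `|s| <= `|a| + 3 * e1 * L ->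
      enorm (w + s *: n) <= 3 * L.
    move=> sle; apply: le_trans (enormD _ _) _; rewrite enormZ n1 mulr1 -/L.
    lra.
  have nn : dot n n = 1 by rewrite -sqr_enorm n1 expr1n.
  have abs1 : `|s1| <= `|a| + 3 * e1 * L.
    by rewrite ler_norml /s1; have := ler_norm a; have := ler_norm (- a);
      rewrite normrN; lra.
  have abs2 : `|s2| <= `|a| + 3 * e1 * L.
    by rewrite ler_norml /s2; have := ler_norm a; have := ler_norm (- a);
      rewrite normrN; lra.
  have F1 : F (p + (w + s1 *: n)) <= 0.
    have /andP[_] := Fv _ (in_range _ abs1).
    rewrite dotDr dotZr nn mulr1 -/a /s1 => /le_trans; apply.
    by rewrite (_ : _ + _ = 0) ?mulr0//; ring.
  have F2 : 0 <= F (p + (w + s2 *: n)).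
    have /andP[+ _] := Fv _ (in_range _ abs2).
    rewrite dotDr dotZr nn mulr1 -/a /s2; apply: le_trans.
    by rewrite (_ : _ - _ = 0) ?mulr0//; ring.
  have [t [t0 t1]] := IVT_segment F_cont F1 F2.
  set y := _ + t *: _ => Fy.
  pose s := s1 + t * (s2 - s1).
  have ys : p + w - y = - s *: n.
    rewrite /y /s; apply/rowP => i; rewrite !mxE; ring.
  apply: le_trans (edist_set_le _ (_ : Gamma F y)) _ => //.
  rewrite ys enormZ n1 mulr1 normrN ler_norml.
  have : 0 <= t * (3 * e1 * L) by rewrite mulr_ge0.
  have : 0 <= (1 - t) * (3 * e1 * L) by rewrite mulr_ge0// subr_ge0.
  rewrite /s /s1 /s2 => h1 h2.
  have := ler_norm a; have := ler_norm (- a); rewrite normrN => h3 h4.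
  by apply/andP; split; lra.
have lower : `|a| - 3 * e1 * L <= edist_set (Gamma F) (p + w).
  apply: edist_set_ge => [|y Fy]; first by exists p.
  have e1L : 0 <= 3 * e1 * L by rewrite !mulr_ge0// ltW.
  have [far|near] := leP L (enorm (p + w - y)); first by lra.
  have yp : enorm (y - p) <= 3 * L.
    rewrite (le_trans (enorm_triangle (p + w) _ _))// enormB.
    by rewrite [p + w - p]addrAC subrr add0r -/L; lra.
  have := Fv _ yp; rewrite subrKC (Fy : F y = 0) pmulr_rle0// pmulr_rge0//.
  move=> ny.
  have : `|dot n (p + w - y)| <= enorm (p + w - y) by exact: dot_unit_le.
  apply: le_trans.
  have -> : p + w - y = w - (y - p) by apply/rowP => i; rewrite !mxE; ring.
  rewrite dotDr dotNr -/a; have := lerB_dist a (dot n (y - p)).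
  have : `|dot n (y - p)| <= 3 * e1 * L by rewrite ler_norml; lra.
  lra.
have sp : sdist F p = 0 by rewrite /sdist edist_set0// mulr0.
rewrite sp subr0 -/a.
have e1L9 : 9 * e1 * L <= e * L by rewrite ler_wpM2r.
have e1L : 0 <= e1 * L by rewrite mulr_ge0// ltW.
have wL : enorm w <= 3 * L by rewrite -/L; lra.
have /andP[Fw1 Fw2] := Fv _ wL.
have [a_gt|a_le] := ltP (3 * e1 * L) a.
  have Fw : 0 < F (p + w).
    by apply: lt_le_trans Fw1; rewrite mulr_gt0// subr_gt0.
  have aE : `|a| = a by rewrite ger0_norm//; lra.
  rewrite /sdist gtr0_sg// mul1r ler_norml; rewrite aE in upper lower; lra.
have [a_lt|a_ge] := ltP a (- (3 * e1 * L)).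
  have Fw : F (p + w) < 0.
    by apply: le_lt_trans Fw2 _; rewrite pmulr_rlt0// -/a; lra.
  have aE : `|a| = - a by rewrite ler0_norm//; lra.
  rewrite /sdist ltr0_sg// mulN1r ler_norml; rewrite aE in upper lower; lra.
have a_abs : `|a| <= 3 * e1 * L by rewrite ler_norml a_le a_ge.
apply: le_trans (ler_normB _ _) _; rewrite normr_sdist.
by lra.
Qed.

End SignedDistance.

(** * Normal segments shorter than the reach *)

Section Reach.
Variable R : realType.
Implicit Types (x y p q u : 'rV[R]_3) (A : set 'rV[R]_3).

(** The distance to [A] grows at unit speed when [x] moves away from its only
    nearest point [q].  A point [y] of [A] lying in nearly the same direction
    as [q] recedes at a speed larger than [c]; the other points form a compact
    set that misses [q], so they are farther than [q] by a positive margin. *)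
Lemma edist_set_ascent A x q (c : R) : compact A ->
  nearest A x q -> (forall y, nearest A x y -> y = q) ->
  0 < edist_set A x -> 0 <= c -> c < 1 ->
  exists2 t1 : R, 0 < t1 & forall t, 0 < t -> t <= t1 ->
    edist_set A x + c * t <=
      edist_set A (x + t *: ((enorm (x - q))^-1 *: (x - q))).
Proof.
move=> cA [Aq xq] uq; set d := edist_set A x in xq * => d0 c0 c1.
rewrite xq; set u := _ *: _.
have u1 : enorm u = 1.
  by rewrite enormZ xq ger0_norm ?invr_ge0 ?(ltW d0)// mulVf// gt_eqF.
have uq_d : dot u (x - q) = d.
  by rewrite dotZl -sqr_enorm xq expr2 mulrA mulVf ?mul1r// gt_eqF.
have A0 : A !=set0 by exists q.
have aligned y t : 0 <= t -> A y -> c * d <= dot u (x - y) ->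
    d + c * t <= enorm (x + t *: u - y).
  move=> t0 Ay uy; have dy : d <= enorm (x - y) by exact: edist_set_le.
  rewrite -ler_sqr ?nnegrE ?enorm_ge0 ?addr_ge0 ?mulr_ge0 ?(ltW d0)//.
  rewrite addrAC sqr_enormD dotZr [dot _ u]dotC enormZ u1 mulr1 ger0_norm//.
  have : d ^+ 2 <= enorm (x - y) ^+ 2.
    by rewrite ler_sqr ?nnegrE ?enorm_ge0 ?(ltW d0).
  have : t * (c * d) <= t * dot u (x - y) by rewrite ler_wpM2l.
  have : c ^+ 2 * t ^+ 2 <= t ^+ 2.
    by rewrite ler_piMl ?sqr_ge0// expr_le1// ltW.
  by rewrite sqrrD exprMn; lra.
(* the points of A whose direction differs from that of q *)
pose B := A `&` [set y | dot u (x - y) <= c * d].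
have [B0|/set0P B0] := eqVneq B set0.
  exists 1 => // t t0 _; apply: edist_set_ge => // y Ay.
  apply: (aligned y t (ltW t0) Ay); rewrite leNgt; apply/negP => /ltW uy.
  by have : B y by []; rewrite B0.
have dot_cont : continuous (fun y => dot u (x - y)).
  apply: lipschitz_continuous => y z; rewrite -[- dot _ _]dotNr -dotDr.
  apply: le_trans (ler_norm _) _; apply: le_trans (dot_unit_le _ u1) _.
  by rewrite opprB addrC addrA subrK enormB.
have cB : compact B.
  apply: (subclosed_compact _ cA); last by move=> y [].
  apply: closedI; last exact: closed_sublevel.
  by apply: compact_closed cA; exact: norm_hausdorff.
have xdist_cont : continuous (fun y => enorm (x - y)).
  by under eq_fun do rewrite enormB; exact: dist_continuous.
have [m [Am mle] mmin] := compact_argmin B0 cB xdist_cont.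
have md : d < enorm (x - m).
  rewrite lt_def edist_set_le// andbT; apply/negP => /eqP xm.
  have mq : m = q by apply: uq.
  by move: mle; rewrite mq /= uq_d ler_pMl// leNgt c1.
exists ((enorm (x - m) - d) / 2) => [|t t0].
  by rewrite divr_gt0// subr_gt0.
rewrite ler_pdivlMr// => tm; apply: edist_set_ge => // y Ay.
have [uy|/ltW uy] := leP (c * d) (dot u (x - y)).
  exact: aligned (ltW t0) Ay uy.
have ct : c * t <= t by rewrite ler_piMl// ltW.
have := mmin y (conj Ay uy).
have := enorm_triangle (x + t *: u) x y.
rewrite opprD addrA subrr add0r enormN enormZ u1 mulr1 gtr0_norm//.
by lra.
Qed.

Lemma reach_unique A (r : R) : (r%:E < reach A)%E ->
  forall x, edist_set A x <= r -> exists! y, nearest A x y.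
Proof.
move=> /ereal_sup_gt[_ [r' r'P <-]]; rewrite lte_fin => rr' x xr.
exact: r'P (le_lt_trans xr rr').
Qed.

Lemma nearest_proj (F : 'rV[R]_3 -> R) x :
  (exists! y, nearest (Gamma F) x y) -> nearest (Gamma F) x (Defs.proj F x).
Proof. by case=> y [yP _]; apply: (@xgetPex _ 0); exists y. Qed.

End Reach.

Section NormalSegment.
Variables (R : realType) (F : 'rV[R]_3 -> R) (p n : 'rV[R]_3) (r s : R).
Let G := Gamma F.
Hypothesis F_cont : continuous F.
Hypothesis G_compact : compact G.
Hypothesis Gp : G p.
Hypothesis n1 : enorm n = 1.
Hypothesis sdist_n : expands (sdist F) p n.
Hypothesis r_gt0 : 0 < r.
Hypothesis r_unique :
  forall x, edist_set G x <= r -> exists! y, nearest G x y.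
(* the side of the surface: the sign of F along the segment *)
Hypothesis s_sign : s = 1 \/ s = -1.
Implicit Types (x y q u : 'rV[R]_3).

Let G0 : G !=set0. Proof. by exists p. Qed.

Let norm_s : `|s| = 1.
Proof. by case: s_sign => ->; rewrite ?normrN1 ?normr1. Qed.

Let ss : s * s = 1.
Proof. by case: s_sign => ->; rewrite ?mulrNN mulr1. Qed.

Let sF_cont : continuous (fun x => s * F x).
Proof. exact: continuous_scale. Qed.

Let edist_le_p x : edist_set G x <= enorm (x - p).
Proof. exact: edist_set_le. Qed.

Let sF_gt0 x : 0 <= s * F x -> 0 < edist_set G x -> 0 < s * F x.
Proof.
move=> sFx dx; rewrite lt_def sFx andbT mulf_neq0//.
  by rewrite -normr_eq0 norm_s oner_eq0.
by apply: contraTneq dx => Fx; rewrite edist_set0// ltxx.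
Qed.

(** By the expansion of the signed distance at [p], moving from [p] a little
    in the direction [s n] leads to the side [s] of the surface and gains
    distance at a speed arbitrarily close to 1. *)
Let near_start (c : R) : c < 1 -> exists x : 'rV[R]_3,
  [/\ enorm (x - p) <= r, 0 <= s * F x & c * enorm (x - p) < edist_set G x].
Proof.
move=> c1; have e0 : 0 < (1 - c) / 2 by rewrite divr_gt0// subr_gt0.
pose e := Num.min ((1 - c) / 2) (1 / 2).
have {}e0 : 0 < e by rewrite lt_min e0 divr_gt0.
have e_half : e <= 1 / 2 by rewrite ge_min lexx orbT.
have e_c : e <= (1 - c) / 2 by rewrite ge_min lexx.
have [d d0 sd] := sdist_n e0.
pose t := Num.min r (d / 2).
have t0 : 0 < t by rewrite lt_min r_gt0 divr_gt0.
have td : t < d.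
  by rewrite gt_min ltr_pdivrMr// mulr_natr mulr2n ltrDl d0 orbT.
pose w := (s * t) *: n.
have nw : enorm w = t by rewrite enormZ n1 mulr1 normrM norm_s mul1r gtr0_norm.
have := sd w; rewrite nw => /(_ td).
rewrite [sdist F p]/sdist edist_set0// mulr0 subr0 dotZr -sqr_enorm n1.
rewrite expr1n mulr1 => sdw.
have {}sdw : t - e * t <= s * sdist F (p + w).
  have : `|s * (sdist F (p + w) - s * t)| <= e * t.
    by rewrite normrM norm_s mul1r.
  by rewrite mulrBr [s * (s * t)]mulrA ss mul1r ler_norml => /andP[+ _]; lra.
have et : e * t <= 1 / 2 * t by rewrite ler_pM2r.
have sdw0 : 0 < s * sdist F (p + w) by lra.
have dwE : s * sdist F (p + w) <= edist_set G (p + w).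
  by rewrite -normr_sdist (le_trans (ler_norm _))// normrM norm_s mul1r.
exists (p + w); rewrite [p + w - p]addrAC subrr add0r nw; split.
- by rewrite ge_min lexx.
- move: sdw0; rewrite /sdist mulrA.
  have [Fw|Fw|->] := ltgtP (F (p + w)) 0; last by rewrite mulr0.
    rewrite ltr0_sg//; case: s_sign => -> => [|_].
      by rewrite [1 * -1]mul1r mulN1r oppr_gt0 ltNge edist_set_ge0.
    by rewrite mulN1r oppr_ge0 ltW.
  rewrite gtr0_sg//; case: s_sign => -> => [_|].
    by rewrite mul1r ltW.
  by rewrite mulr1 mulN1r oppr_gt0 ltNge edist_set_ge0.
- have : e * t <= (1 - c) / 2 * t by rewrite ler_pM2r.
  have : 0 < (1 - c) * t by rewrite mulr_gt0// subr_gt0.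
  by lra.
Qed.

Let side_ball : set 'rV[R]_3 :=
  [set x | enorm (x - p) <= r] `&` [set x | 0 <= s * F x].

Let side_ball_compact : compact side_ball.
Proof.
apply: (@enorm_bounded_compact _ p r) => [|x []//].
apply: closedI; first by apply: closed_sublevel; exact: dist_continuous.
exact: closed_superlevel.
Qed.

(** As in the variational principle of Ekeland: a maximizer of
    [edist_set G x - c * enorm (x - p)] on the half ball is off the surface by
    [near_start], and it lies on the sphere because elsewhere moving away from
    its nearest point at a speed larger than [c] would improve it. *)
Let almost_far (c : R) : 0 <= c -> c < 1 ->
  exists x, [/\ side_ball x, enorm (x - p) = r & c * r <= edist_set G x].
Proof.
move=> c0 c1.
have [x0 [x0r x0s x0c]] := near_start c1.
pose phi x := edist_set G x - c * enorm (x - p).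
have phi_cont : continuous phi.
  have c_dist : continuous (fun x => c * enorm (x - p)).
    by apply: continuous_scale; exact: dist_continuous.
  move=> x; exact: (continuousB (@edist_set_continuous _ _ G0 x) (c_dist x)).
have [|x [xr xs] xmax] :=
  compact_argmax (A := side_ball) _ side_ball_compact phi_cont.
  by exists x0.
have phi_x : 0 < phi x.
  by apply: lt_le_trans (xmax x0 _) => //; rewrite subr_gt0.
have dx : 0 < edist_set G x.
  apply: lt_le_trans phi_x _; rewrite lerBlDr lerDl mulr_ge0//.
  exact: enorm_ge0.
exists x; suff xpr : enorm (x - p) = r.
  by split=> //; rewrite -xpr; move: phi_x; rewrite subr_gt0 => /ltW.
apply/eqP; rewrite eq_le xr leNgt; apply/negP => xr'.
have [q [xq uq]] := r_unique (le_trans (edist_le_p x) xr).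
(* any speed strictly between c and 1 *)
pose c' := (1 + c) / 2.
have [t1 t1_gt0 asc] := edist_set_ascent (c := c') G_compact xq
  (fun y yP => esym (uq y yP)) dx ltac:(rewrite /c'; lra)
  ltac:(rewrite /c'; lra).
move: asc; set u := _ *: _ => asc.
have u1 : enorm u = 1.
  rewrite enormZ (xq.2) ger0_norm ?invr_ge0 ?(ltW dx)//.
  by rewrite mulVf// gt_eqF.
have [d d0 sFd] := continuous_enorm_ball (@sF_cont x) (sF_gt0 xs dx).
pose t := Num.min t1 (Num.min (r - enorm (x - p)) (d / 2)).
have t0 : 0 < t by rewrite !lt_min t1_gt0 subr_gt0 xr' divr_gt0.
have tt1 : t <= t1 by rewrite ge_min lexx.
have tr : t <= r - enorm (x - p) by rewrite !ge_min lexx orbT.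
have td : t < d.
  by rewrite !gt_min [d / 2 < d]ltr_pdivrMr// mulr_natr mulr2n ltrDl d0 !orbT.
have nt : enorm (t *: u) = t by rewrite enormZ u1 mulr1 gtr0_norm.
have xtp : enorm (x + t *: u - p) <= enorm (x - p) + t.
  by rewrite addrAC (le_trans (enormD _ _))// nt.
have : phi (x + t *: u) <= phi x.
  apply: xmax; split => /=; first by lra.
  have := sFd (x + t *: u); rewrite [x + _ - x]addrAC subrr add0r nt.
  move=> /(_ td); rewrite ltr_norml => /andP[+ _].
  by rewrite ltrBrDl subrr => /ltW.
have := asc t t0 tt1.
have : c * enorm (x + t *: u - p) <= c * (enorm (x - p) + t).
  by rewrite ler_wpM2l.
have : c * t < c' * t by rewrite ltr_pM2r// /c'; lra.
by rewrite /phi; lra.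
Qed.

(** Take a point of the half sphere at the largest distance from the surface;
    by [almost_far] this distance is at least [c r] for all [c < 1]. *)
Let far_point :
  exists x, [/\ 0 < s * F x, enorm (x - p) = r & edist_set G x = r].
Proof.
pose S := side_ball `&` [set x | r <= enorm (x - p)].
have cS : compact S.
  apply: (subclosed_compact _ side_ball_compact); last by move=> x [].
  apply: closedI.
    by apply: compact_closed side_ball_compact; exact: norm_hausdorff.
  by apply: closed_superlevel; exact: dist_continuous.
have [|x [[xr xs] xr'] xmax] :=
  compact_argmax (A := S) _ cS (edist_set_continuous G0).
  have [x [x1 x2 _]] := almost_far (lexx 0) ltr01.
  by exists x; split => //=; rewrite x2.
have {xr'}xr : enorm (x - p) = r by apply/eqP; rewrite eq_le xr.
have dx : edist_set G x = r.
  apply/eqP; rewrite eq_le -{1}xr edist_le_p/=.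
  rewrite leNgt; apply/negP => dr.
  (* c is chosen so that c r lies strictly between edist_set G x and r *)
  pose c := (edist_set G x / r + 1) / 2.
  have q0 : 0 <= edist_set G x / r by rewrite divr_ge0 ?edist_set_ge0 ?ltW.
  have q1 : edist_set G x / r < 1 by rewrite ltr_pdivrMr// mul1r.
  have [y [y1 y2 y3]] := almost_far (c := c) ltac:(rewrite /c; lra)
    ltac:(rewrite /c; lra).
  have := xmax y (conj y1 _); rewrite /= y2 lexx => /(_ isT).
  apply/negP; rewrite -ltNge; apply: lt_le_trans y3.
  by rewrite -ltr_pdivrMr// /c; lra.
by exists x; split=> //; apply: sF_gt0; rewrite ?dx.
Qed.

(** Along the segment from [p] to the far point the distance to [p] is the
    distance to the surface, and [sdist_n] leaves [s n] as its only possible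
    direction. *)
Lemma edist_set_normal_segment : edist_set G (p + (s * r) *: n) = r.
Proof.
have [x [sFx xr dx]] := far_point.
pose u := r^-1 *: (x - p).
have u1 : enorm u = 1.
  by rewrite enormZ xr ger0_norm ?invr_ge0 ?(ltW r_gt0)// mulVf// gt_eqF.
have xE : x = p + r *: u by rewrite /u scalerA divff ?scale1r ?subrKC// gt_eqF.
have du t : 0 <= t -> t <= r -> edist_set G (p + t *: u) = t.
  move=> t0 tr; apply/eqP; rewrite eq_le; apply/andP; split.
    rewrite (le_trans (edist_le_p _))// [p + _ - p]addrAC subrr add0r.
    by rewrite enormZ u1 mulr1 ger0_norm.
  have := edist_set_lip x (p + t *: u) G0; rewrite dx xE opprD addrACA subrr.
  by rewrite add0r -scalerBl enormZ u1 mulr1 ger0_norm ?subr_ge0//; lra.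
have sFu t : 0 < t -> t <= r -> 0 < s * F (p + t *: u).
  move=> t0 tr; rewrite ltNge; apply/negP => Ft.
  have [a [a0 a1]] := IVT_segment sF_cont Ft (ltW sFx).
  pose b := t + a * (r - t).
  have -> : p + t *: u + a *: (x - (p + t *: u)) = p + b *: u.
    by rewrite [in LHS]xE; apply/rowP => i; rewrite !mxE /b; ring.
  have b0 : 0 < b by rewrite ltr_wpDr// mulr_ge0 ?subr_ge0.
  have br : b <= r.
    have : a * (r - t) <= r - t by rewrite ler_piMl ?subr_ge0.
    by rewrite /b; lra.
  move=> sFb; have : edist_set G (p + b *: u) = 0.
    apply: edist_set0; apply/eqP.
    by rewrite -(mul1r (F _)) -ss -mulrA sFb mulr0.
  by rewrite du// ?(ltW b0)// => b_eq0; rewrite b_eq0 ltxx in b0.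
have sdu t : 0 < t -> t <= r -> sdist F (p + t *: u) = s * t.
  move=> t0 tr; rewrite /sdist -/G du ?(ltW t0)//; congr (_ * _).
  have := sFu t t0 tr; case: s_sign => ->.
    by rewrite mul1r => /gtr0_sg.
  by rewrite mulN1r oppr_gt0 => /ltr0_sg.
have nu : dot n u = s.
  apply/eqP; rewrite -subr_eq0 -normr_le0; apply/ler_addgt0Pr => e e0.
  rewrite add0r.
  have [d d0 sd] := sdist_n e0.
  pose t := Num.min r (d / 2).
  have t0 : 0 < t by rewrite lt_min r_gt0 divr_gt0.
  have tr : t <= r by rewrite ge_min lexx.
  have td : t < d.
    by rewrite gt_min ltr_pdivrMr// mulr_natr mulr2n ltrDl d0 orbT.
  have nt : enorm (t *: u) = t by rewrite enormZ u1 mulr1 gtr0_norm.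
  have := sd (t *: u); rewrite nt => /(_ td).
  rewrite sdu// [sdist F p]/sdist edist_set0// mulr0 subr0 dotZr distrC.
  rewrite [s * t]mulrC -mulrBr normrM gtr0_norm// mulrC ler_pM2r//.
suff uE : s *: n = u by rewrite mulrC -scalerA uE -xE.
apply: dot_unit_eq1 => //; first by rewrite enormZ norm_s n1 mulr1.
by rewrite dotZl nu ss.
Qed.

End NormalSegment.

(** * Diameters of simplices *)

Section Simplices.
Variables (R : realType) (M : mesh R).
Implicit Types (K : {set vertex M}) (x y : 'rV[R]_3).

Lemma pos_simplex K v : v \in K -> simplex K (pos v).
Proof.
move=> vK; exists (fun u => (u == v)%:R); split => [u||].
- by rewrite ler0n.
- by rewrite (bigD1 v)//= eqxx big1 ?addr0// => u /andP[_ /negPf->].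
- rewrite (bigD1 v)//= eqxx scale1r big1 ?addr0// => u /andP[_ /negPf->].
  by rewrite scale0r.
Qed.

(** The distance to a fixed point is convex, so on a simplex it is bounded by
    its values at the vertices. *)
Lemma simplex_dist_vertex K (c : R) x y : simplex K x ->
  (forall v, v \in K -> enorm (pos v - y) <= c) -> enorm (x - y) <= c.
Proof.
move=> [w [w0 w1 ->]] Kc.
rewrite -[y]scale1r -w1 scaler_suml -sumrB.
under eq_bigr do rewrite -scalerBr.
apply: le_trans (enorm_sum _ _) _; rewrite -[leRHS]mul1r -w1 mulr_suml.
by apply: ler_sum => v vK; rewrite enormZ ger0_norm// ler_wpM2l// Kc.
Qed.

Lemma simplex_dist_le K (c : R) x y :
  (forall u v, u \in K -> v \in K -> enorm (pos u - pos v) <= c) ->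
  simplex K x -> simplex K y -> enorm (x - y) <= c.
Proof.
move=> Kc Kx Ky; apply: simplex_dist_vertex Kx _ => u uK.
by rewrite enormB; apply: simplex_dist_vertex Ky _ => v vK; exact: Kc.
Qed.

Lemma diam_simplex_le K (c : R) : simplex K !=set0 ->
  (forall u v, u \in K -> v \in K -> enorm (pos u - pos v) <= c) ->
  diam (simplex K) <= c.
Proof.
move=> [x Kx] Kc; apply: ge_sup; first by exists (enorm (x - x)), (x, x).
by move=> _ [[y z] /= [Ky Kz] <-]; exact: (simplex_dist_le Kc Ky Kz).
Qed.

Lemma le_diam_simplex K x y : simplex K x -> simplex K y ->
  enorm (x - y) <= diam (simplex K).
Proof.
move=> Kx Ky; apply: ub_le_sup; last by exists (x, y).
(* some finite bound is needed for the supremum to dominate its elements *)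
pose c := \sum_(uv : vertex M * vertex M) enorm (pos uv.1 - pos uv.2).
exists c => _ [[y' z'] /= [Ky' Kz'] <-]; apply: (simplex_dist_le _ Ky' Kz').
move=> u v _ _; rewrite /c (bigD1 (u, v))//= lerDl sumr_ge0// => uv _.
exact: enorm_ge0.
Qed.

End Simplices.

(** * The displacement *)

Section Displacement.
Variables (R : realType) (F : 'rV[R]_3 -> R).
Hypothesis F_level : compact_smooth_regular_level_set F.
Implicit Types (a p : 'rV[R]_3) (b : 'rV[R]_3 -> bool).

(** On the surface [normal], defined by partial derivatives, is a true gradient
    of the signed distance and has unit length. *)
Lemma normal_expands p : Gamma F p ->
  enorm (normal F p) = 1 /\ expands (sdist F) p (normal F p).
Proof.
case: F_level => smooth_F _ reg_F Fp; have g0 := reg_F p Fp.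
have nexp := sdist_expands (smooth_F 0%N) Fp g0
  (class_C1_expands p (smooth_F 1%N)).
have nE : normal F p = (enorm (grad F p))^-1 *: grad F p.
  exact: expands_grad nexp.
rewrite nE; split=> //; rewrite enormZ ger0_norm ?invr_ge0 ?enorm_ge0//.
by rewrite mulVf// enorm_eq0.
Qed.

Lemma side_sign b a : side F b a = 1 \/ side F b a = -1.
Proof.
rewrite /side; have [_|a0] := eqVneq (sdist F a) 0.
  by case: (b a); rewrite ?expr1 ?expr0; [right|left].
have [a_lt|a_gt|a_eq] := ltgtP (sdist F a) 0.
- by right; exact: ltr0_sg.
- by left; exact: gtr0_sg.
- by rewrite a_eq eqxx in a0.
Qed.

(** A vertex closer than [r = rho * h] to the surface travels at most [r] to its
    projection and then [r] along the normal, where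
    [edist_set_normal_segment] applies. *)
Lemma displace_dist b (rho h : R) a : Gamma F !=set0 ->
  0 < rho * h -> ((rho * h)%:E < reach (Gamma F))%E ->
  enorm (displace F b rho h a - a) <= 2 * (rho * h) /\
  rho * h <= edist_set (Gamma F) (displace F b rho h a).
Proof.
move=> G0 r0 /reach_unique r_unique; rewrite /displace normr_sdist.
have [far|/ltW near] := leP (rho * h) (edist_set (Gamma F) a).
  by rewrite subrr enorm0 mulr_ge0// ltW.
have [Gp ap] := nearest_proj (r_unique a near).
set p := Defs.proj F a in Gp ap *.
have [n1 nexp] := normal_expands Gp.
have s_sign := side_sign b a.
have [smooth_F cG _] := F_level.
split; last first.
  by rewrite (edist_set_normal_segment
    (smooth_F 0%N) cG Gp n1 nexp r0 r_unique s_sign).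
rewrite addrAC (le_trans (enormD _ _))// enormB ap enormZ n1 mulr1 normrM.
have -> : `|side F b a| = 1 by case: s_sign => ->; rewrite ?normrN1 ?normr1.
by rewrite mul1r gtr0_norm//; lra.
Qed.

End Displacement.

Theorem lemma2p3 (R : realType) (sigma cm CM : R)
  (sigma_gt0 : 0 < sigma) (cm_gt0 : 0 < cm) (CM_gt0 : 0 < CM) :
  exists2 rho_star : R, 0 < rho_star &
  forall (F : 'rV[R]_3 -> R) (lo hi : 'rV[R]_3) (rho : R),
    compact_smooth_regular_level_set F ->
    (forall i, lo ord0 i < hi ord0 i) ->
    0 < rho -> rho <= rho_star ->
    exists c0 C0 : R, [/\ 0 < c0, 0 < C0 &
      forall (h : R) (M0 : mesh R) (b : 'rV[R]_3 -> bool),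
        0 < h ->
        ((rho * h)%:E < reach (Gamma F))%E ->
        conforming_tetrahedral_mesh M0 (box lo hi) ->
        shape_regular M0 sigma ->
        quasi_uniform M0 cm CM h ->
        let M := adjusted_mesh F b rho h M0 in
        forall T : {set vertex M}, T \in cells M ->
          simplex T `&` Gamma F !=set0 ->
          forall a : vertex M, a \in T ->
            2 * c0 * diam (simplex T) <= `|sdist F (pos a)|
            /\ `|sdist F (pos a)| <= C0 * diam (simplex T)].
Proof.
exists 1 => // F lo hi rho F_level _ rho0 _.
have den0 : 0 < CM + 4 * rho by lra.
(* this c0 turns diam T <= (CM + 4 rho) h into 2 c0 diam T <= rho h *)
exists (rho / (2 * (CM + 4 * rho))), 1; split => //.
  by rewrite divr_gt0// mulr_gt0.
move=> h M0 b h0 h_reach _ _ qu M T TM [x [Tx Gx]] a aT.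
have G0 : Gamma F !=set0 by exists x.
have r0 : 0 < rho * h by rewrite mulr_gt0.
have disp v := displace_dist F_level b v G0 r0 h_reach.
have Ta : simplex T (pos a) := pos_simplex aT.
rewrite normr_sdist; split; last first.
  by rewrite mul1r (le_trans (edist_set_le _ Gx))// le_diam_simplex.
apply: le_trans (disp (pos (a : vertex M0))).2.
have diamT : diam (simplex T) <= (CM + 4 * rho) * h.
  apply: diam_simplex_le => [|u v uT vT]; first by exists (pos a).
  have [_ dM0] := qu _ TM.
  have uv0 : enorm (@pos R M0 u - @pos R M0 v) <= CM * h.
    by apply: le_trans dM0; apply: le_diam_simplex; exact: pos_simplex.
  have [du _] := disp (@pos R M0 u); have [dv _] := disp (@pos R M0 v).
  have := enorm_triangle (@pos R M0 u) (@pos R M u) (@pos R M v).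
  have := enorm_triangle (@pos R M0 v) (@pos R M0 u) (@pos R M v).
  rewrite [enorm (@pos R M0 v - _)]enormB.
  move: du dv; rewrite -[displace F b rho h (@pos R M0 u)]/(@pos R M u).
  rewrite -[displace F b rho h (@pos R M0 v)]/(@pos R M v).
  lra.
have -> : rho * h = 2 * (rho / (2 * (CM + 4 * rho))) * ((CM + 4 * rho) * h).
  by field; rewrite gt_eqF.
by rewrite ler_wpM2l// mulr_ge0// ltW// divr_gt0// mulr_gt0.
Qed.
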